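(* Let $F$ be an $h$-conformal semi-invariant submersion from a quaternionic Kähler manifold $(M,J_1,J_2,J_3,g_M)$ onto a Riemannian manifold $(N,g_N)$, with dilation $\lambda$, such that $\{J_1,J_2,J_3\}$ is an $h$-conformal semi-invariant basis. For $\alpha\in\{1,2,3\}$ (indices modulo $3$) consider the condition $(\mathrm{VI}_\alpha)$: for all $U,V\in\Gamma(\mathcal{D}_1)$ and $X\in\Gamma((\ker F_* )^\perp)$, $$(\nabla F_* )(V,J_\alpha U)\in\Gamma(F_*\mu^{J_\alpha})$$ and $$\begin{aligned}g_N\left((\nabla F_* )(V,J_\alpha U),F_*C_{J_\alpha}X\right)={}&\lambda^2g_M\left(U,\mathcal{T}_V\omega_{J_\alpha}B_{J_\alpha}X\right)\\&-\lambda^2\left(g_M(\omega_{\alpha+2}(V)\phi_{J_{\alpha+1}}U,J_\alpha X)+g_M(\omega_{\alpha+2}(V)\omega_{J_{\alpha+1}}U,J_\alpha X)\right)\\&+\lambda^2\left(g_M(\omega_{\alpha+1}(V)\phi_{J_{\alpha+2}}U,J_\alpha X)+g_M(\omega_{\alpha+1}(V)\omega_{J_{\alpha+2}}U,J_\alpha X)\right).\end{aligned}$$ Then the following four conditions are equivalent: (a) the distribution $\mathcal{D}_1$ defines a totally geodesic foliation on $M$; (b) $(\mathrm{VI}_1)$; (c) $(\mathrm{VI}_2)$; (d) $(\mathrm{VI}_3)$.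
   Context: All objects are smooth; $\Gamma(\cdot)$ denotes sections. Indices $\alpha\in\{1,2,3\}$ are taken modulo $3$. An almost quaternionic Hermitian manifold $(M,E,g_M)$ is a Riemannian manifold of dimension divisible by $4$ with a rank $3$ subbundle $E\subset\operatorname{End}(TM)$ having near each point a local basis $\{J_1,J_2,J_3\}$ of sections (a quaternionic Hermitian basis) with $J_\alpha^2=-\mathrm{id}$, $J_\alpha J_{\alpha+1}=-J_{\alpha+1}J_\alpha=J_{\alpha+2}$, $g_M(J_\alpha X,J_\alpha Y)=g_M(X,Y)$. It is quaternionic Kähler if there are locally defined $1$-forms $\omega_1,\omega_2,\omega_3$ with $\nabla_XJ_\alpha=\omega_{\alpha+2}(X)J_{\alpha+1}-\omega_{\alpha+1}(X)J_{\alpha+2}$, $\nabla$ the Levi-Civita connection of $g_M$. An $h$-conformal (horizontally conformal) submersion $F:(M,g_M)\to(N,g_N)$ ($\dim M>\dim N$) with dilation $\lambda:M\to(0,\infty)$ is a surjective map of maximal rank with $g_N(F_*V,F_*W)=\lambda^2g_M(V,W)$ for $V,W\in(\ker F_* )^\perp$. It is an $h$-conformal semi-invariant submersion if near each point there is a quaternionic Hermitian basis $\{J_1,J_2,J_3\}$ (an $h$-conformal semi-invariant basis) and a distribution $\mathcal{D}_1\subset\ker F_*$ such that, with $\mathcal{D}_2$ the orthogonal complement of $\mathcal{D}_1$ in $\ker F_*$, $R(\mathcal{D}_1)=\mathcal{D}_1$ and $R(\mathcal{D}_2)\subset(\ker F_* )^\perp$ for every $R\in\{J_1,J_2,J_3\}$.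 One writes $(M,J_1,J_2,J_3,g_M)$ for $(M,E,g_M)$ with such a basis; statements involving the $J_\alpha$ are understood on the domain of the basis. $\mu^{J_\alpha}$ is the orthogonal complement of $J_\alpha\mathcal{D}_2$ in $(\ker F_* )^\perp$. For $X\in\Gamma(\ker F_* )$ write $J_\alpha X=\phi_{J_\alpha}X+\omega_{J_\alpha}X$ with $\phi_{J_\alpha}X\in\Gamma(\mathcal{D}_1)$, $\omega_{J_\alpha}X\in\Gamma(J_\alpha\mathcal{D}_2)$; for $Z\in\Gamma((\ker F_* )^\perp)$ write $J_\alpha Z=B_{J_\alpha}Z+C_{J_\alpha}Z$ with $B_{J_\alpha}Z\in\Gamma(\mathcal{D}_2)$, $C_{J_\alpha}Z\in\Gamma(\mu^{J_\alpha})$. (The $1$-forms $\omega_1,\omega_2,\omega_3$ are not to be confused with the operators $\omega_{J_\alpha}$.) $\mathcal{V}$, $\mathcal{H}$ are the orthogonal projections onto $\ker F_*$ and $(\ker F_* )^\perp$; $\mathcal{T}_EG=\mathcal{H}\nabla_{\mathcal{V}E}\mathcal{V}G+\mathcal{V}\nabla_{\mathcal{V}E}\mathcal{H}G$ for vector fields $E,G$ on $M$. The second fundamental form of $F$ is $(\nabla F_* )(X,Y)=\nabla^F_XF_*Y-F_*(\nabla_XY)$, with $\nabla^F$ the pullback to $F^{-1}TN$ of the Levi-Civita connection of $g_N$. A distribution $D$ defines a totally geodesic foliation if $\nabla_XY\in\Gamma(D)$ for all $X,Y\in\Gamma(D)$. *)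

(* Defs.v *)
From HB Require Import structures.
From mathcomp Require Import all_boot all_order all_algebra.
From mathcomp Require Import all_classical all_reals all_analysis.

Set Implicit Arguments.
Unset Strict Implicit.
Unset Printing Implicit Defensive.

Import Order.TTheory GRing.Theory Num.Theory numFieldNormedType.Exports.

Local Open Scope classical_set_scope.
Local Open Scope ring_scope.

(* The index set {1, 2, 3} modulo 3 is 'Z_3, with 3 = 0. Distributions and    *)
(* subbundles are families of subspaces. Fields are total functions of which  *)
(* only the values on the relevant open set matter.                           *)

(* C^oo on the open set A: every iterated directional derivative of f is      *)
(* (Frechet) differentiable at every point of A.                              *)
Definition smooth_on (R : realType) (V W : normedModType R)
    (A : set V) (f : V -> W) : Prop :=
  forall (vs : seq V) (x : V), A x ->
    differentiable (foldr (fun v (g : V -> W) (y : V) => 'D_v g y : W) f vs) x.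

Record chart (R : realType) (n : nat) (T : topologicalType) := Chart {
  cdom : set T;
  cmap : T -> 'rV[R]_n;
  cinv : 'rV[R]_n -> T;
  cdom_open : open cdom;
  cimg_open : open (cmap @` cdom);
  cmapK : forall p, cdom p -> cinv (cmap p) = p;
  cmap_continuous : forall p, cdom p -> {for p, continuous cmap};
  cinv_continuous : forall x, (cmap @` cdom) x -> {for x, continuous cinv} }.

(* A smooth n-manifold; its atlas is indexed by the points, chart_at p being  *)
(* a chart around p. The tangent space at p is 'rV[R]_n, a tangent vector     *)
(* being given by its coordinates in the chart chart_at p.                    *)
Record manifold (R : realType) (n : nat) := Manifold {
  mpoint :> topologicalType;
  manifold_hausdorff : hausdorff_space mpoint;
  manifold_second_countable : @second_countable mpoint;
  chart_at : mpoint -> chart R n mpoint;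
  mem_chart_at : forall p, cdom (chart_at p) p;
  transition_smooth : forall p q,
    smooth_on (cmap (chart_at p) @` (cdom (chart_at p) `&` cdom (chart_at q)))
      (cmap (chart_at q) \o cinv (chart_at p)) }.

Section Calculus.
Context {R : realType}.

Definition smooth_fun (m : nat) (M : manifold R m) (O : set M) (f : M -> R) :=
  forall p, smooth_on (cmap (chart_at p) @` (cdom (chart_at p) `&` O))
    (f \o cinv (chart_at p) : 'rV[R]_m -> R).

Definition smooth_map (m n : nat) (M : manifold R m) (N : manifold R n)
    (F : M -> N) :=
  continuous F /\
  forall p q,
    smooth_on
      (cmap (chart_at p) @` (cdom (chart_at p) `&` F @^-1` cdom (chart_at q)))
      (cmap (chart_at q) \o F \o cinv (chart_at p)).

(* v f, for v tangent at p *)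
Definition dfun (m : nat) (M : manifold R m) (f : M -> R) (p : M)
    (v : 'rV[R]_m) : R :=
  'D_v (f \o cinv (chart_at p)) (cmap (chart_at p) p).

(* F_* v, for v tangent at p *)
Definition push (m n : nat) (M : manifold R m) (N : manifold R n)
    (F : M -> N) (p : M) (v : 'rV[R]_m) : 'rV[R]_n :=
  'D_v (cmap (chart_at (F p)) \o F \o cinv (chart_at p)) (cmap (chart_at p) p).

(* the coordinates, in the chart chart_at q, of v tangent at p *)
Definition tcoord (m : nat) (M : manifold R m) (q p : M) (v : 'rV[R]_m) :
    'rV[R]_m :=
  'D_v (cmap (chart_at q) \o cinv (chart_at p)) (cmap (chart_at p) p).

(* s is a smooth section over O of the pullback bundle F^{-1}TN; vector       *)
(* fields are the case F = id.                                                *)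
Definition smooth_along (m n : nat) (M : manifold R m) (N : manifold R n)
    (F : M -> N) (O : set M) (s : M -> 'rV[R]_n) :=
  forall p q,
    smooth_on
      (cmap (chart_at p) @`
         (cdom (chart_at p) `&` O `&` F @^-1` cdom (chart_at q)))
      (fun x => let r := cinv (chart_at p) x in tcoord q (F r) (s r)).

Definition smooth_vf (m : nat) (M : manifold R m) (O : set M)
    (X : M -> 'rV[R]_m) :=
  smooth_along (@id M) O X.

(* Gamma(D) over O, for a family D of subsets of the fibres of F^{-1}TN *)
Definition section_along (m n : nat) (M : manifold R m) (N : manifold R n)
    (F : M -> N) (O : set M) (D : M -> set 'rV[R]_n) (s : M -> 'rV[R]_n) :=
  smooth_along F O s /\ forall p, O p -> D p (s p).

Definition section (m : nat) (M : manifold R m) (O : set M)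
    (D : M -> set 'rV[R]_m) (X : M -> 'rV[R]_m) :=
  section_along (@id M) O D X.

Definition smooth_1form (m : nat) (M : manifold R m) (O : set M)
    (w : M -> {scalar 'rV[R]_m}) :=
  forall (U : set M) X, open U -> U `<=` O -> smooth_vf U X ->
    smooth_fun U (fun p => w p (X p)).

Definition smooth_endo (m : nat) (M : manifold R m) (O : set M)
    (A : M -> 'End('rV[R]_m)) :=
  forall (U : set M) X, open U -> U `<=` O -> smooth_vf U X ->
    smooth_vf U (fun p => A p (X p)).

Definition distribution (m : nat) (M : manifold R m) (O : set M)
    (D : M -> {vspace 'rV[R]_m}) :=
  forall p, O p -> exists (U : set M) (k : nat) (X : 'I_k -> M -> 'rV[R]_m),
    [/\ open U, U p, U `<=` O, forall i, smooth_vf U (X i)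
      & forall q, U q -> basis_of (D q) [seq X i q | i <- enum 'I_k]].

End Calculus.

Section Riemannian.
Context {R : realType}.

Definition riemannian_metric (m : nat) (M : manifold R m)
    (g : M -> 'rV[R]_m -> 'rV[R]_m -> R) :=
  [/\ forall p a u v w, g p (a *: u + v) w = a * g p u w + g p v w,
      forall p u v, g p u v = g p v u,
      forall p u, u != 0 -> 0 < g p u u
    & forall (O : set M) X Y, open O -> smooth_vf O X -> smooth_vf O Y ->
        smooth_fun O (fun p => g p (X p) (Y p))].

(* A linear connection on the pullback bundle F^{-1}TN: nabla p v s is the    *)
(* derivative at p, in the direction of the tangent vector v, of the local    *)
(* section s, so that nabla_X s = (fun p => nabla p (X p) s).                 *)
Definition connection_along (m n : nat) (M : manifold R m) (N : manifold R n)
    (F : M -> N)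
    (nabla : M -> 'rV[R]_m -> (M -> 'rV[R]_n) -> 'rV[R]_n) :=
  forall O : set M, open O ->
  [/\ forall p a u v s, O p -> smooth_along F O s ->
        nabla p (a *: u + v) s = a *: nabla p u s + nabla p v s,
      forall p v s t, O p -> smooth_along F O s -> smooth_along F O t ->
        nabla p v (fun q => s q + t q) = nabla p v s + nabla p v t,
      forall p v f s, O p -> smooth_fun O f -> smooth_along F O s ->
        nabla p v (fun q => f q *: s q) =
          dfun f p v *: s p + f p *: nabla p v s,
      forall p v s t, O p -> smooth_along F O s -> smooth_along F O t ->
        (forall q, O q -> s q = t q) -> nabla p v s = nabla p v t
    & forall X s, smooth_vf O X -> smooth_along F O s ->
        smooth_along F O (fun p => nabla p (X p) s)].

Definition levi_civita (m : nat) (M : manifold R m)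
    (g : M -> 'rV[R]_m -> 'rV[R]_m -> R)
    (nabla : M -> 'rV[R]_m -> (M -> 'rV[R]_m) -> 'rV[R]_m) :=
  [/\ connection_along (@id M) nabla,
      forall (O : set M) X Y p v, open O -> O p ->
        smooth_vf O X -> smooth_vf O Y ->
        dfun (fun q => g q (X q) (Y q)) p v =
          g p (nabla p v X) (Y p) + g p (X p) (nabla p v Y)
    & (* nabla_X Y - nabla_Y X = [X, Y], as derivations of functions *)
      forall (O : set M) X Y f p, open O -> O p ->
        smooth_vf O X -> smooth_vf O Y -> smooth_fun O f ->
        dfun f p (nabla p (X p) Y - nabla p (Y p) X) =
          dfun (fun q => dfun f q (Y q)) p (X p)
          - dfun (fun q => dfun f q (X q)) p (Y p)].

Definition pullback_connection (m n : nat) (M : manifold R m)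
    (N : manifold R n) (F : M -> N)
    (nablaN : N -> 'rV[R]_n -> (N -> 'rV[R]_n) -> 'rV[R]_n)
    (nablaF : M -> 'rV[R]_m -> (M -> 'rV[R]_n) -> 'rV[R]_n) :=
  connection_along F nablaF /\
  forall (O : set N) Y p v, open O -> O (F p) -> smooth_vf O Y ->
    nablaF p v (Y \o F) = nablaN (F p) (push F p v) Y.

Definition totally_geodesic (m : nat) (M : manifold R m)
    (nabla : M -> 'rV[R]_m -> (M -> 'rV[R]_m) -> 'rV[R]_m)
    (O : set M) (D : M -> {vspace 'rV[R]_m}) :=
  forall X Y, section O (fun p => [set` D p]) X ->
    section O (fun p => [set` D p]) Y ->
    section O (fun p => [set` D p]) (fun p => nabla p (X p) Y).

End Riemannian.

Section Quaternionic.
Context {R : realType} {m : nat} {M : manifold R m}.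
Variables (E : M -> {vspace 'End('rV[R]_m)}).
Variable g : M -> 'rV[R]_m -> 'rV[R]_m -> R.
Variable nabla : M -> 'rV[R]_m -> (M -> 'rV[R]_m) -> 'rV[R]_m.

Definition quaternionic_hermitian_basis (O : set M)
    (J : 'Z_3 -> M -> 'End('rV[R]_m)) :=
  [/\ open O /\ forall a, smooth_endo O (J a),
      forall p, O p -> basis_of (E p) [:: J 1 p; J 2 p; J 3 p],
      forall a p v, O p -> J a p (J a p v) = - v,
      forall a p v, O p ->
        J a p (J (a + 1) p v) = J (a + 2) p v /\
        - J (a + 1) p (J a p v) = J (a + 2) p v
    & forall a p v w, O p -> g p (J a p v) (J a p w) = g p v w].

Definition almost_quaternionic_hermitian :=
  [/\ (4 %| m)%N, riemannian_metric g
    & forall p, exists O J, O p /\ quaternionic_hermitian_basis O J].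

(* nabla_X J_a = w_(a+2)(X) J_(a+1) - w_(a+1)(X) J_(a+2) on O, where          *)
(* (nabla_X J) Y = nabla_X (J Y) - J (nabla_X Y)                              *)
Definition connection_forms (O : set M) (J : 'Z_3 -> M -> 'End('rV[R]_m))
    (w : 'Z_3 -> M -> {scalar 'rV[R]_m}) :=
  (forall a, smooth_1form O (w a)) /\
  forall a (U : set M) Y p v, open U -> U `<=` O -> U p -> smooth_vf U Y ->
    nabla p v (fun q => J a q (Y q)) - J a p (nabla p v Y) =
      w (a + 2) p v *: J (a + 1) p (Y p) - w (a + 1) p v *: J (a + 2) p (Y p).

Definition quaternionic_kahler :=
  almost_quaternionic_hermitian /\
  forall p, exists O J w,
    [/\ O p, quaternionic_hermitian_basis O J & connection_forms O J w].

End Quaternionic.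

Section Submersion.
Context {R : realType} {m n : nat} {M : manifold R m} {N : manifold R n}.
Variable E : M -> {vspace 'End('rV[R]_m)}.
Variable gM : M -> 'rV[R]_m -> 'rV[R]_m -> R.
Variable gN : N -> 'rV[R]_n -> 'rV[R]_n -> R.
Variable nablaM : M -> 'rV[R]_m -> (M -> 'rV[R]_m) -> 'rV[R]_m.
Variable nablaF : M -> 'rV[R]_m -> (M -> 'rV[R]_n) -> 'rV[R]_n.
Variable F : M -> N.
Variable lam : M -> R.

Definition vertical (p : M) : set 'rV[R]_m := [set v | push F p v = 0].

Definition horizontal (p : M) : set 'rV[R]_m :=
  [set v | forall u, vertical p u -> gM p v u = 0].

Definition h_conformal_submersion :=
  [/\ (n < m)%N,
      smooth_map F /\ forall y, exists x, F x = y,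
      forall p w, exists v, push F p v = w,
      smooth_fun setT lam /\ forall p, 0 < lam p
    & forall p v w, horizontal p v -> horizontal p w ->
        gN (F p) (push F p v) (push F p w) = lam p ^+ 2 * gM p v w].

Section Decomposition.
Variable J : 'Z_3 -> M -> 'End('rV[R]_m).
Variable D1 : M -> {vspace 'rV[R]_m}.

Definition D2 (p : M) : set 'rV[R]_m :=
  [set v | vertical p v /\ forall u, u \in D1 p -> gM p v u = 0].

Definition JD2 (a : 'Z_3) (p : M) : set 'rV[R]_m := J a p @` D2 p.

Definition mu (a : 'Z_3) (p : M) : set 'rV[R]_m :=
  [set v | horizontal p v /\ forall u, JD2 a p u -> gM p v u = 0].

(* the A-component of v in the direct sum of A and B *)
Definition component (A B : set 'rV[R]_m) (v : 'rV[R]_m) : 'rV[R]_m :=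
  xget 0 [set u | A u /\ B (v - u)].

Definition verproj (p : M) := component (vertical p) (horizontal p).
Definition horproj (p : M) := component (horizontal p) (vertical p).

Definition phiJ (a : 'Z_3) (p : M) (v : 'rV[R]_m) :=
  component [set` D1 p] (JD2 a p) (J a p v).
Definition omegaJ (a : 'Z_3) (p : M) (v : 'rV[R]_m) :=
  component (JD2 a p) [set` D1 p] (J a p v).
Definition BJ (a : 'Z_3) (p : M) (v : 'rV[R]_m) :=
  component (D2 p) (mu a p) (J a p v).
Definition CJ (a : 'Z_3) (p : M) (v : 'rV[R]_m) :=
  component (mu a p) (D2 p) (J a p v).

(* O'Neill's tensor T *)
Definition tensorT (X Y : M -> 'rV[R]_m) (p : M) : 'rV[R]_m :=
  horproj p (nablaM p (verproj p (X p)) (fun q => verproj q (Y q)))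
  + verproj p (nablaM p (verproj p (X p)) (fun q => horproj q (Y q))).

Definition second_fundamental_form (X Y : M -> 'rV[R]_m) (p : M) : 'rV[R]_n :=
  nablaF p (X p) (fun q => push F q (Y q)) - push F p (nablaM p (X p) Y).

Definition semi_invariant_basis (O : set M) :=
  [/\ quaternionic_hermitian_basis E gM O J,
      distribution O D1,
      forall p, O p -> [set` D1 p] `<=` vertical p,
      forall a p, O p -> J a p @` [set` D1 p] = [set` D1 p]
    & forall a p, O p -> JD2 a p `<=` horizontal p].

Definition condition_VI (O : set M) (w : 'Z_3 -> M -> {scalar 'rV[R]_m})
    (a : 'Z_3) :=
  forall U V X : M -> 'rV[R]_m,
    section O (fun p => [set` D1 p]) U ->
    section O (fun p => [set` D1 p]) V ->
    section O horizontal X ->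
    let JU q := J a q (U q) in
    let wBX q := omegaJ a q (BJ a q (X q)) in
    section_along F O (fun p => push F p @` mu a p)
      (second_fundamental_form V JU) /\
    forall p, O p ->
      gN (F p) (second_fundamental_form V JU p) (push F p (CJ a p (X p))) =
        lam p ^+ 2 * gM p (U p) (tensorT V wBX p)
        - lam p ^+ 2 *
            (gM p (w (a + 2) p (V p) *: phiJ (a + 1) p (U p)) (J a p (X p))
             + gM p (w (a + 2) p (V p) *: omegaJ (a + 1) p (U p))
                 (J a p (X p)))
        + lam p ^+ 2 *
            (gM p (w (a + 1) p (V p) *: phiJ (a + 2) p (U p)) (J a p (X p))
             + gM p (w (a + 1) p (V p) *: omegaJ (a + 2) p (U p))
                 (J a p (X p))).

End Decomposition.

Definition h_conformal_semi_invariant_submersion :=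
  h_conformal_submersion /\
  forall p, exists O J D1, O p /\ semi_invariant_basis J D1 O.

End Submersion.

(* Main.v *)
From HB Require Import structures.
Require Import Defs.
From mathcomp Require Import all_boot all_order all_algebra.
From mathcomp Require Import ring.
From mathcomp Require Import all_classical all_reals all_analysis.

(* Since J_a U is vertical, (nabla F_* )(V, J_a U) = - F_* (nabla_V J_a U), and  *)
(* modulo D_1 one has nabla_V J_a U = J_a nabla_V U. Conformality on horizontal  *)
(* vectors, metric compatibility and J_a C_a X = - X - J_a B_a X turn the        *)
(* difference of the two sides of the equation in (VI_a) into                    *)
(* - lam^2 g_M(nabla_V U, X), the terms in the connection forms being zero.      *)
(* Hence the equation says that nabla_V U is vertical (take for X the horizontal *)
(* part of nabla_V U), while (nabla F_* )(V, J_a U) in F_* mu says that          *)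
(* nabla_V U is orthogonal to D_2: together, nabla_V U lies in D_1. Applying the *)
(* connection to B_a X requires that the horizontal projection of a smooth       *)
(* vector field be smooth; in charts it is v |-> v A (A^T G^-1 A)^-1 A^T G^-1,   *)
(* with A the Jacobian matrix of F and G the Gram matrix of g_M.                 *)

Set Implicit Arguments.
Unset Strict Implicit.
Unset Printing Implicit Defensive.

Import Order.TTheory GRing.Theory Num.Theory numFieldNormedType.Exports.

Local Open Scope classical_set_scope.
Local Open Scope ring_scope.

(** * Smooth functions on normed modules *)

(** Fix sections U, V of D_1 and put Z = nabla_V U. The tangent space is the orthogonal sum of D_1,
    D_2 and the horizontal space, so Z lies in D_1 iff its horizontal part and its D_2 part vanish.
    For any one index, (VI_a) tests exactly these two parts. By [condition_VI_defect] and
    [omega_terms] the two sides of its equation differ by lam^2 g_M(Z, X), which for X the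
    horizontal part of Z forces that part to be 0. By [nablaJ_horizontal], g_M(nabla_V J_a U, J_a d)
    = g_M(Z, d) for d in D_2, and membership in F_* mu makes the left side 0. The index [a] stays
    arbitrary in both directions, so each (VI_a) is equivalent to (a).

    The analytic burden is smoothness: the connection laws apply only to smooth fields, and B_a X
    and the horizontal part of Z come from pointwise projections. [smooth_horproj] settles this
    through a matrix formula in fixed charts; [smooth_on_coind] reduces smoothness of such formulas
    to the rules of differentiation. *)

Lemma near_eq_differentiable (R : numFieldType) (V W : normedModType R)
    (f g : V -> W) (x : V) :
  (\near x, f x = g x) -> differentiable f x -> differentiable g x.
Proof.
move=> fg /diff_locallyP[cf].
move/eqaddoP => fE.
have gE : g \o shift x = cst (g x) + 'd f x +o_ 0 id.
  apply/eqaddoP => e e0; have := fE e e0.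
  have fg0 : \forall h \near 0, f (h + x) = g (h + x).
    have := fg; rewrite (near_shift 0 x)/=; apply: filterS => y /=.
    by rewrite subr0.
  apply: filterS2 fg0 => h /= fgh.
  by rewrite !fctE /= fgh (nbhs_singleton fg).
(* The expansion of [g] uses the differential of [f]; uniqueness identifies it with the differential
   of [g]. *)
have dE := diff_unique cf gE.
by apply/diff_locallyP; rewrite dE.
Qed.

Section SmoothOn.
Variables (R : realType) (V : normedModType R).
Implicit Types A : set V.

Lemma smooth_onW (W : normedModType R) A (f : V -> W) x :
  smooth_on A f -> A x -> differentiable f x.
Proof. by move=> fs Ax; exact: (fs [::]). Qed.

Lemma smooth_on_derive (W : normedModType R) A (f : V -> W) v :
  smooth_on A f -> smooth_on A (fun y => 'D_v f y).
Proof. by move=> fs vs x Ax; have := fs (rcons vs v) x Ax; rewrite foldr_rcons. Qed.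

Lemma open_near_eq (W : Type) A (f g : V -> W) x : open A -> A x ->
  (forall y, A y -> f y = g y) -> \near x, f x = g x.
Proof.
move=> oA Ax fg; have := open_nbhs_nbhs (conj oA Ax).
by apply: filterS.
Qed.

(* Coinduction: a class of functions that are differentiable on A and whose
   derivatives agree on A with members of the class is made of smooth functions. *)
Lemma smooth_on_coind (W : normedModType R) A (P : (V -> W) -> Prop) : open A ->
  (forall f, P f -> forall x, A x -> differentiable f x) ->
  (forall f v, P f -> exists2 h, P h & forall x, A x -> 'D_v f x = h x) ->
  forall f g, P f -> (forall x, A x -> f x = g x) -> smooth_on A g.
Proof.
(* The derivative taken first stands last in the list, hence induction from the right. *)
move=> oA Pd PD f g Pf fg vs; elim/last_ind: vs f g Pf fg => [|vs v IH] f g Pf fg x Ax.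
  by apply: near_eq_differentiable (Pd f Pf x Ax); exact: open_near_eq fg.
rewrite foldr_rcons; have [h Ph fh] := PD f v Pf.
apply: (IH h) => // y Ay; rewrite -fh //; apply: near_eq_derive.
exact: open_near_eq fg.
Qed.

Lemma smooth_on_eq (W : normedModType R) A (f g : V -> W) : open A ->
  (forall x, A x -> f x = g x) -> smooth_on A f -> smooth_on A g.
Proof.
move=> oA fg fs; apply: (smooth_on_coind (P := smooth_on A)) fg => //.
- by move=> h hs x Ax; exact: smooth_onW hs Ax.
- by move=> h v hs; exists (fun y => 'D_v h y) => //; exact: smooth_on_derive.
Qed.

Lemma smooth_on_sub (W : normedModType R) A B (f : V -> W) :
  A `<=` B -> smooth_on B f -> smooth_on A f.
Proof. by move=> AB fs vs x /AB; exact: fs. Qed.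

Lemma smooth_on_local (W : normedModType R) A (f : V -> W) :
  (forall x, A x -> exists2 B, B x & smooth_on B f) -> smooth_on A f.
Proof. by move=> fs vs x /fs[B Bx]; exact. Qed.

Lemma smooth_on_cst (W : normedModType R) A (a : W) : smooth_on A (fun=> a).
Proof.
(* Coinduction requires an open set and [A] is arbitrary, so smoothness is shown on the whole
   space. *)
apply: (@smooth_on_sub _ _ setT) => //.
apply: (@smooth_on_coind _ _ (fun f => exists b, f = fun=> b) _ _ _ (fun=> a)).
- exact: openT.
- by move=> f [b ->] x _; exact: differentiable_cst.
- move=> f v [b ->]; exists (fun=> 0); first by exists 0.
  by move=> x _; exact: derive_cst.
- by exists a.
- by [].
Qed.

Lemma smooth_on_D (W : normedModType R) A (f g : V -> W) : open A ->
  smooth_on A f -> smooth_on A g -> smooth_on A (fun x => f x + g x).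
Proof.
move=> oA fs gs.
apply: (@smooth_on_coind _ _
  (fun h => exists f g, [/\ smooth_on A f, smooth_on A g & h = f + g])
  oA _ _ (f + g)) => //.
- by move=> _ [a [b [sa sb ->]]] x Ax; apply: differentiableD; exact: smooth_onW Ax.
- move=> _ v [a [b [sa sb ->]]].
  exists ((fun x => 'D_v a x) + (fun x => 'D_v b x)).
    by do 2 eexists; split; last reflexivity; exact: smooth_on_derive.
  move=> x Ax; rewrite deriveD //; apply: diff_derivable; exact: smooth_onW Ax.
- by exists f, g.
Qed.

(* Closed under derivation by the product and quotient rules, so the coinduction
   lemma applies to products and inverses at once. *)
Inductive smooth_gen A : (V -> R) -> Prop :=
| GenBase f of smooth_on A f : smooth_gen A f
| GenAdd f g of smooth_gen A f & smooth_gen A g : smooth_gen A (f + g)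
| GenMul f g of smooth_gen A f & smooth_gen A g : smooth_gen A (f * g)
| GenInv f of smooth_gen A f & (forall x, A x -> f x != 0) :
    smooth_gen A (fun x => (f x)^-1).

Lemma smooth_gen_differentiable A f x :
  smooth_gen A f -> A x -> differentiable f x.
Proof.
move=> + Ax; elim=> {f}.
- by move=> f fs; exact: smooth_onW Ax.
- by move=> f g _ df _ dg; exact: differentiableD.
- by move=> f g _ df _ dg; exact: differentiableM.
- by move=> f _ df f0; apply: differentiableV => //; exact: f0.
Qed.

Lemma smooth_gen_smooth A f : open A -> smooth_gen A f -> smooth_on A f.
Proof.
move=> oA fs; apply: (@smooth_on_coind _ _ (smooth_gen A) oA _ _ f) => // {f fs}.
  by move=> f fs x Ax; exact: smooth_gen_differentiable Ax.
have der f x v : smooth_gen A f -> A x -> derivable f x v.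
  by move=> fs Ax; apply: diff_derivable; exact: smooth_gen_differentiable Ax.
move=> f v; elim=> {f}.
- move=> f fs; exists (fun x => 'D_v f x) => //.
  by constructor; exact: smooth_on_derive.
- move=> f g fs [f' f's fE] gs [g' g's gE]; exists (f' + g'); first exact: GenAdd.
  by move=> x Ax; rewrite deriveD ?fE ?gE //; exact: der.
- move=> f g fs [f' f's fE] gs [g' g's gE]; exists (f * g' + g * f').
    by apply: GenAdd; exact: GenMul.
  by move=> x Ax; rewrite deriveM ?fE ?gE //; exact: der.
- move=> f fs [f' f's fE] f0.
  pose k x := (f x)^-1; have ks : smooth_gen A k by exact: GenInv.
  (* The derivative -f'/f^2, with the sign as a constant factor because [smooth_gen] has no
     constructor for opposites. *)
  exists ((fun=> -1) * (k * k) * f').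
    apply: GenMul f's; apply: GenMul (GenMul ks ks).
    by apply: GenBase; exact: smooth_on_cst.
  move=> x Ax; rewrite deriveV ?f0 ?fE //; last exact: der.
  by rewrite !fctE /k mulN1r -exprVn expr2.
Qed.

Lemma smooth_on_M A (f g : V -> R) : open A ->
  smooth_on A f -> smooth_on A g -> smooth_on A (fun x => f x * g x).
Proof. by move=> oA *; apply: smooth_gen_smooth => //; apply: GenMul; exact: GenBase. Qed.

Lemma smooth_on_V A (f : V -> R) : open A -> (forall x, A x -> f x != 0) ->
  smooth_on A f -> smooth_on A (fun x => (f x)^-1).
Proof.
by move=> oA *; apply: smooth_gen_smooth => //; apply: GenInv => //; exact: GenBase.
Qed.

Lemma smooth_on_sum (W : normedModType R) A I (r : seq I) (P : pred I)
    (f : I -> V -> W) : open A ->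
  (forall i, smooth_on A (f i)) -> smooth_on A (fun x => \sum_(i <- r | P i) f i x).
Proof.
move=> oA fs; elim: r => [|i r IH].
  apply: (@smooth_on_eq _ _ (fun=> 0)) => //; last exact: smooth_on_cst.
  by move=> x _; rewrite big_nil.
apply: (@smooth_on_eq _ _ (fun x => (if P i then f i x else 0) +
    \sum_(i <- r | P i) f i x)) => //.
  by move=> x _; rewrite big_cons; case: (P i); rewrite ?add0r.
apply: smooth_on_D => //; case: (P i) => //; exact: smooth_on_cst.
Qed.

Lemma smooth_on_prod A I (r : seq I) (P : pred I) (f : I -> V -> R) : open A ->
  (forall i, smooth_on A (f i)) -> smooth_on A (fun x => \prod_(i <- r | P i) f i x).
Proof.
move=> oA fs; elim: r => [|i r IH].
  apply: (@smooth_on_eq R _ (fun=> 1)) => //; last exact: smooth_on_cst.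
  by move=> x _; rewrite big_nil.
apply: (@smooth_on_eq R _ (fun x => (if P i then f i x else 1) *
    \prod_(i <- r | P i) f i x)) => //.
  by move=> x _; rewrite big_cons; case: (P i); rewrite ?mul1r.
apply: smooth_on_M => //; case: (P i) => //; exact: smooth_on_cst.
Qed.

Lemma smooth_on_scalel (W : normedModType R) A (f : V -> R) (a : W) : open A ->
  smooth_on A f -> smooth_on A (fun x => f x *: a).
Proof.
move=> oA fs.
apply: (@smooth_on_coind _ _
  (fun h : V -> W => exists2 f : V -> R, smooth_on A f & h = fun x => f x *: a)
  oA _ _ (fun x => f x *: a)) => //.
- by move=> _ [g gs ->] x Ax; apply: differentiableZl; exact: smooth_onW Ax.
- move=> _ v [g gs ->]; exists (fun x => 'D_v g x *: a).
    by exists (fun x => 'D_v g x) => //; exact: smooth_on_derive.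
  move=> x Ax; have gd := smooth_onW gs Ax.
  by rewrite !deriveE ?diffZl //; exact: differentiableZl.
- by exists f.
Qed.

Section Matrices.
Variables m n : nat.
Implicit Type M : V -> 'M[R]_(m, n).

Lemma smooth_on_coord A M i j : open A ->
  smooth_on A M -> smooth_on A (fun x => M x i j).
Proof.
move=> oA Ms.
apply: (@smooth_on_coind _ _
  (fun h => exists2 M : V -> 'M[R]_(m, n), smooth_on A M & h = fun x => M x i j)
  oA _ _ (fun x => M x i j)) => //.
- move=> _ [g gs ->] x Ax.
  apply: (@differentiable_comp _ _ _ _ g (fun N : 'M[R]_(m, n) => N i j : R)).
    exact: smooth_onW Ax.
  exact: differentiable_coord.
- move=> _ v [g gs ->]; exists (fun x => 'D_v g x i j).
    by exists (fun x => 'D_v g x) => //; exact: smooth_on_derive.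
  move=> x Ax; rewrite derive_mx ?mxE //; apply: diff_derivable.
  exact: smooth_onW Ax.
- by exists M.
Qed.

Lemma smooth_on_mx A M : open A ->
  (forall i j, smooth_on A (fun x => M x i j)) -> smooth_on A M.
Proof.
move=> oA Ms; apply: (@smooth_on_eq _ _
  (fun x => \sum_i \sum_j M x i j *: delta_mx i j)) => //.
  by move=> x _; rewrite -matrix_sum_delta.
by do 2!apply: smooth_on_sum => // ?; exact: smooth_on_scalel.
Qed.

End Matrices.

Lemma smooth_on_mulmx A m n p (M : V -> 'M[R]_(m, n)) (N : V -> 'M[R]_(n, p)) :
  open A -> smooth_on A M -> smooth_on A N -> smooth_on A (fun x => M x *m N x).
Proof.
move=> oA Ms Ns; apply: smooth_on_mx => // i j.
apply: (@smooth_on_eq R _ (fun x => \sum_k M x i k * N x k j)) => //.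
  by move=> x _; rewrite mxE.
by apply: smooth_on_sum => // k; apply: smooth_on_M => //; exact: smooth_on_coord.
Qed.

Lemma smooth_on_trmx A m n (M : V -> 'M[R]_(m, n)) :
  open A -> smooth_on A M -> smooth_on A (fun x => (M x)^T).
Proof.
move=> oA Ms; apply: smooth_on_mx => // i j.
apply: (@smooth_on_eq R _ (fun x => M x j i)) => //; last exact: smooth_on_coord.
by move=> x _; rewrite mxE.
Qed.

Lemma smooth_on_det A n (M : V -> 'M[R]_n) :
  open A -> (forall i j, smooth_on A (fun x => M x i j)) ->
  smooth_on A (fun x => \det (M x)).
Proof.
move=> oA Ms; apply: smooth_on_sum => // s; apply: smooth_on_M => //.
  exact: smooth_on_cst.
by apply: smooth_on_prod.
Qed.

(** By the adjugate formula the entries are cofactors divided by a nonvanishing determinant. *)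
Lemma smooth_on_invmx A n (M : V -> 'M[R]_n) :
  open A -> (forall x, A x -> M x \in unitmx) ->
  smooth_on A M -> smooth_on A (fun x => invmx (M x)).
Proof.
move=> oA Mu Ms; have Mij i j := smooth_on_coord i j oA Ms.
apply: (@smooth_on_eq _ _ (fun x => (\det (M x))^-1 *: \adj (M x))) => //.
  by move=> x Ax; rewrite /invmx Mu.
apply: smooth_on_mx => // i j.
apply: (@smooth_on_eq R _ (fun x => (\det (M x))^-1 * \adj (M x) i j)) => //.
  by move=> x _; rewrite !mxE.
apply: smooth_on_M => //.
  apply: smooth_on_V => //; last exact: smooth_on_det.
  by move=> x /Mu; rewrite unitmxE unitfE.
apply: (@smooth_on_eq R _ (fun x => (-1) ^+ (j + i) * \det (row' j (col' i (M x))))) => //.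
  by move=> x _; rewrite mxE.
apply: smooth_on_M => //; first exact: smooth_on_cst.
apply: smooth_on_det => // k l.
by apply: (@smooth_on_eq R _ (fun x => M x (lift j k) (lift i l))) => // x _; rewrite !mxE.
Qed.

End SmoothOn.

Lemma smooth_on_jacobian (R : realType) m n (A : set 'rV[R]_m)
    (f : 'rV[R]_m -> 'rV[R]_n) :
  open A -> smooth_on A f -> smooth_on A (fun x => 'J f x).
Proof.
move=> oA fs; apply: smooth_on_mx => // i j.
apply: (@smooth_on_eq _ _ R _ (fun x => ('D_(delta_mx 0 i) f x) 0 j)) => //.
  move=> x Ax; rewrite deriveEjacobian; last exact: smooth_onW Ax.
  by rewrite -rowE mxE.
by apply: smooth_on_coord => //; exact: smooth_on_derive.
Qed.

(** * Chart representations *)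

Section Charts.
Variable R : realType.

Definition chart_rep m n (M : manifold R m) (N : manifold R n) (F : M -> N)
    (p : M) (q : N) : 'rV[R]_m -> 'rV[R]_n :=
  cmap (chart_at q) \o F \o cinv (chart_at p).

(** Tangent vectors are rows, so this matrix acts on the right and composition multiplies in the
    order of travel. The charts at [p] and [q] stay fixed while [r] moves. *)
Definition chart_jac m n (M : manifold R m) (N : manifold R n) (F : M -> N)
    (p : M) (q : N) (r : M) : 'M[R]_(m, n) :=
  'J (chart_rep F p q) (cmap (chart_at p) r).

Definition chart_img m (M : manifold R m) (p : M) (B : set M) : set 'rV[R]_m :=
  cmap (chart_at p) @` (cdom (chart_at p) `&` B).

Lemma open_chart_img m (M : manifold R m) (p : M) (B : set M) :
  open B -> open (chart_img p B).
Proof.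
move=> oB; rewrite openE => _ [r [pr Br] <-]; rewrite /interior.
have nimg : nbhs (cmap (chart_at p) r) (cmap (chart_at p) @` cdom (chart_at p)).
  by apply: open_nbhs_nbhs; split; [exact: cimg_open | exists r].
have /cinv_continuous ccont : (cmap (chart_at p) @` cdom (chart_at p)) (cmap (chart_at p) r).
  by exists r.
have nB : nbhs (cinv (chart_at p) (cmap (chart_at p) r)) B.
  by rewrite cmapK //; exact: open_nbhs_nbhs.
apply: filterS2 nimg (ccont _ nB) => _ [s ps <-] /=; rewrite cmapK // => Bs.
by exists s.
Qed.

Lemma chart_imgP m (M : manifold R m) (p : M) (B : set M) x :
  chart_img p B x -> exists r, [/\ cdom (chart_at p) r, B r,
    x = cmap (chart_at p) r & cinv (chart_at p) x = r].
Proof. by move=> [r [pr Br] <-]; exists r; rewrite cmapK. Qed.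

Lemma mem_chart_img m (M : manifold R m) (p r : M) (B : set M) :
  cdom (chart_at p) r -> B r -> chart_img p B (cmap (chart_at p) r).
Proof. by move=> pr Br; exists r. Qed.

Lemma smooth_map_id m (M : manifold R m) : smooth_map (@id M).
Proof.
split=> [x|p q]; first exact: cvg_id.
exact: transition_smooth.
Qed.

Section Maps.
Variables (m n : nat) (M : manifold R m) (N : manifold R n) (F : M -> N).
Hypothesis Fs : smooth_map F.

Lemma open_preimage_chart q : open (F @^-1` cdom (chart_at q)).
Proof. by apply: open_comp (cdom_open _) => x _; exact: Fs.1. Qed.

Lemma smooth_chart_rep p q :
  smooth_on (chart_img p (F @^-1` cdom (chart_at q))) (chart_rep F p q).
Proof. exact: Fs.2. Qed.

Lemma differentiable_chart_rep p q r :
  cdom (chart_at p) r -> cdom (chart_at q) (F r) ->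
  differentiable (chart_rep F p q) (cmap (chart_at p) r).
Proof.
by move=> pr qr; apply: (smooth_onW (@smooth_chart_rep p q)); exact: mem_chart_img.
Qed.

Lemma derive_chart_rep p q r v :
  cdom (chart_at p) r -> cdom (chart_at q) (F r) ->
  'D_v (chart_rep F p q) (cmap (chart_at p) r) = v *m chart_jac F p q r.
Proof. by move=> pr qr; rewrite deriveEjacobian //; exact: differentiable_chart_rep. Qed.

Lemma smooth_chart_jac p q :
  smooth_on (chart_img p (F @^-1` cdom (chart_at q)))
    (fun x => chart_jac F p q (cinv (chart_at p) x)).
Proof.
have oI : open (chart_img p (F @^-1` cdom (chart_at q))).
  by apply: open_chart_img; exact: open_preimage_chart.
apply: smooth_on_eq oI _ (smooth_on_jacobian oI (@smooth_chart_rep p q)).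
by move=> x /chart_imgP[r [pr qr -> _]]; rewrite /chart_jac cmapK.
Qed.

Lemma pushE p v : push F p v = v *m chart_jac F p (F p) p.
Proof. by apply: derive_chart_rep; exact: mem_chart_at. Qed.

End Maps.

(** The chain rule. The composite of the two local expressions equals that of [G \o F] only where
    the middle chart covers the image of [F], so derivatives are compared on a neighbourhood. *)
Lemma chart_jac_comp m n k (M : manifold R m) (N : manifold R n)
    (P : manifold R k) (F : M -> N) (G : N -> P) p q s r :
  smooth_map F -> smooth_map G ->
  cdom (chart_at p) r -> cdom (chart_at q) (F r) -> cdom (chart_at s) (G (F r)) ->
  chart_jac (G \o F) p s r = chart_jac F p q r *m chart_jac G q s (F r).
Proof.
move=> Fs Gs pr qr sr.
have FrE : chart_rep F p q (cmap (chart_at p) r) = cmap (chart_at q) (F r).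
  by rewrite /chart_rep /= cmapK.
have dF := differentiable_chart_rep Fs pr qr.
have dG := differentiable_chart_rep Gs qr sr.
have dGF : differentiable (chart_rep G q s) (chart_rep F p q (cmap (chart_at p) r)).
  by rewrite FrE.
pose x := cmap (chart_at p) r.
have near_comp : \near x,
    (chart_rep G q s \o chart_rep F p q) x = chart_rep (G \o F) p s x.
  apply: (open_near_eq (open_chart_img (p := p) (open_preimage_chart Fs q))).
    exact: mem_chart_img.
  by move=> _ /chart_imgP[t [pt qt -> _]]; rewrite /chart_rep /= !cmapK.
apply/row_matrixP => i; rewrite !rowE -[chart_jac (G \o F) _ _ _]/('J _ _).
rewrite -deriveEjacobian; last first.
  by apply: near_eq_differentiable near_comp _; exact: differentiable_comp.
rewrite -(near_eq_derive _ near_comp) deriveE; last exact: differentiable_comp.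
by rewrite diff_comp //= FrE -!deriveE // !derive_chart_rep // mulmxA.
Qed.

(** * Change of charts for tangent vectors and smooth vector fields *)

Section TangentCoordinates.
Variables (m : nat) (M : manifold R m).

Local Notation jac := (chart_jac (@id M)).

Lemma tcoordE (q r : M) v : cdom (chart_at q) r -> tcoord q r v = v *m jac r q r.
Proof.
move=> qr; apply: (derive_chart_rep (@smooth_map_id _ M)) => //.
exact: mem_chart_at.
Qed.

Lemma chart_jac_id (p r : M) : cdom (chart_at p) r -> jac p p r = 1%:M.
Proof.
move=> pr; apply/row_matrixP => i; rewrite !rowE mulmx1.
rewrite -(derive_chart_rep (@smooth_map_id _ M)) //.
rewrite -[RHS](derive_id (cmap (chart_at p) r)); apply: near_eq_derive.
apply: open_near_eq (open_chart_img (p := p) openT) _ _; first exact: mem_chart_img.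
by move=> _ /chart_imgP[t [pt _ -> _]]; rewrite /chart_rep /= cmapK.
Qed.

Lemma chart_jac_trans (p q s r : M) :
  cdom (chart_at p) r -> cdom (chart_at q) r -> cdom (chart_at s) r ->
  jac p s r = jac p q r *m jac q s r.
Proof. by apply: (@chart_jac_comp _ _ _ M M M id id); exact: smooth_map_id. Qed.

Lemma chart_jacK (p q r : M) : cdom (chart_at p) r -> cdom (chart_at q) r ->
  jac p q r *m jac q p r = 1%:M.
Proof. by move=> pr qr; rewrite -chart_jac_trans // chart_jac_id. Qed.

Lemma chart_jacV (p q r : M) : cdom (chart_at p) r -> cdom (chart_at q) r ->
  jac q p r = invmx (jac p q r).
Proof.
move=> pr qr; have [u _] := mulmx1_unit (chart_jacK pr qr).
by rewrite -[LHS](mulKmx u) chart_jacK // mulmx1.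
Qed.

Lemma tcoord_chart (p q r : M) v : cdom (chart_at p) r -> cdom (chart_at q) r ->
  tcoord q r v = tcoord p r v *m jac p q r.
Proof.
move=> pr qr; rewrite (tcoordE _ pr) (tcoordE _ qr) -mulmxA.
by rewrite -(chart_jac_trans (mem_chart_at r) pr qr).
Qed.

(** Smoothness along a map quantifies over two charts. For vector fields the diagonal pairs suffice,
    since passing to another chart multiplies by a smooth Jacobian matrix. *)
Lemma smooth_vfP (O : set M) (X : M -> 'rV[R]_m) : open O ->
  smooth_vf O X <->
  forall p, smooth_on (chart_img p O)
    (fun x => tcoord p (cinv (chart_at p) x) (X (cinv (chart_at p) x))).
Proof.
move=> oO; split=> [Xs p|Xs p q].
  apply: smooth_on_sub (Xs p p) => _ [r [pr Or] <-].
  by exists r.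
rewrite -setIA -/(chart_img p _).
have oI : open (O `&` id @^-1` cdom (chart_at q)).
  by apply: openI => //; exact: (cdom_open (chart_at q)).
apply: (smooth_on_eq (open_chart_img (p := p) oI)
  (f := fun x => tcoord p (cinv (chart_at p) x) (X (cinv (chart_at p) x)) *m
                 jac p q (cinv (chart_at p) x))).
  move=> x /chart_imgP[r [pr [Or qr] -> _]]; rewrite cmapK //.
  by rewrite -tcoord_chart.
apply: smooth_on_mulmx; first exact: open_chart_img.
  apply: smooth_on_sub (Xs p) => _ [r [pr [Or qr]] <-].
  exact: mem_chart_img.
apply: smooth_on_sub (@smooth_chart_jac _ _ _ _ _ (smooth_map_id M) p q).
move=> _ [r [pr [Or qr]] <-].
exact: mem_chart_img.
Qed.

Lemma smooth_vf_sub (O : set M) (X Y : M -> 'rV[R]_m) : open O ->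
  smooth_vf O X -> smooth_vf O Y -> smooth_vf O (fun p => X p - Y p).
Proof.
move=> oO /(smooth_vfP _ oO) Xs /(smooth_vfP _ oO) Ys.
apply/(smooth_vfP _ oO) => p; have oI := open_chart_img (p := p) oO.
apply: (smooth_on_eq oI (f := fun x =>
    tcoord p (cinv (chart_at p) x) (X (cinv (chart_at p) x)) +
    tcoord p (cinv (chart_at p) x) (Y (cinv (chart_at p) x)) *m (- 1%:M))).
  move=> x /chart_imgP[r [pr _ -> _]]; rewrite cmapK // !tcoordE //.
  by rewrite mulmxN mulmx1 mulmxBl.
apply: smooth_on_D => //; apply: smooth_on_mulmx => //; exact: smooth_on_cst.
Qed.

(* The coordinate vector field with constant coordinates v in the chart at p. *)
Definition chart_frame (p : M) (v : 'rV[R]_m) (r : M) := v *m jac p r r.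

Lemma tcoord_chart_frame (p q r : M) v :
  cdom (chart_at p) r -> cdom (chart_at q) r ->
  tcoord q r (chart_frame p v r) = v *m jac p q r.
Proof.
move=> pr qr; rewrite (tcoordE _ qr) -mulmxA.
by rewrite -(chart_jac_trans pr (mem_chart_at r) qr).
Qed.

Lemma chart_frameK (p r : M) v :
  cdom (chart_at p) r -> chart_frame p (tcoord p r v) r = v.
Proof.
move=> pr; rewrite (tcoordE _ pr) /chart_frame -mulmxA.
by rewrite (chart_jacK (mem_chart_at r) pr) mulmx1.
Qed.

Lemma smooth_chart_frame (p : M) v : smooth_vf (cdom (chart_at p)) (chart_frame p v).
Proof.
have op := cdom_open (chart_at p).
apply/(smooth_vfP _ op) => q; have oI := open_chart_img (p := q) op.
(* The coordinates in the chart at [q] involve [jac p q], whereas [smooth_chart_jac] gives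
   smoothness in these coordinates for [jac q p]; hence the inverse. *)
apply: (smooth_on_eq oI
  (f := fun x => v *m invmx (jac q p (cinv (chart_at q) x)))).
  move=> x /chart_imgP[r [qr pr -> _]]; rewrite cmapK //.
  by rewrite tcoord_chart_frame // (chart_jacV qr pr).
apply: smooth_on_mulmx => //; first exact: smooth_on_cst.
apply: smooth_on_invmx => //.
  move=> x /chart_imgP[r [qr pr -> _]]; rewrite cmapK //.
  by have [u _] := mulmx1_unit (chart_jacK qr pr); exact: u.
exact: (smooth_chart_jac (smooth_map_id M)).
Qed.

End TangentCoordinates.

(** * Sections along a map and locality of connections *)

Section SectionsAlong.
Variables (m n : nat) (M : manifold R m) (N : manifold R n) (F : M -> N).
Hypothesis Fs : smooth_map F.

Lemma smooth_along_eq (O : set M) s t : open O ->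
  (forall p, O p -> s p = t p) -> smooth_along F O s -> smooth_along F O t.
Proof.
move=> oO st ss p q; apply: smooth_on_eq (ss p q).
  rewrite -setIA; apply: open_chart_img; apply: openI => //.
  exact: open_preimage_chart.
rewrite -setIA => x /chart_imgP[r [pr [Or qr] -> _]].
by rewrite cmapK // /= (st r Or).
Qed.

Lemma smooth_along0 (O : set M) : smooth_along F O (fun=> 0).
Proof.
move=> p q.
rewrite (_ : (fun _ => _) = fun=> 0); first exact: smooth_on_cst.
by apply/funext => x /=; rewrite /tcoord derive0.
Qed.

(** Locality replaces [s] by the zero section, and additivity gives nabla 0 = nabla 0 + nabla 0. It
    disposes of F_* of a vertical field and of the vertical part of a horizontal one. *)
Lemma connection_along0 nabla (O : set M) p v (s : M -> 'rV[R]_n) : open O -> O p ->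
  connection_along F nabla -> (forall q, O q -> s q = 0) -> nabla p v s = 0.
Proof.
move=> oO Op conn s0; have [_ addn _ eqn _] := conn O oO.
have z0 := @smooth_along0 O.
have zz : smooth_along F O s by apply: smooth_along_eq z0 => // q /s0.
rewrite (eqn _ _ s (fun=> 0)) //; apply: (addIr (nabla p v (fun=> 0))).
rewrite add0r -addn //; congr nabla.
by apply/funext => q; rewrite addr0.
Qed.

End SectionsAlong.

Lemma smooth_vf_eq m (M : manifold R m) (O : set M) X Y : open O ->
  (forall p, O p -> X p = Y p) -> smooth_vf O X -> smooth_vf O Y.
Proof. by apply: smooth_along_eq; exact: smooth_map_id. Qed.

Lemma dfun0 m (M : manifold R m) (O : set M) (f : M -> R) p v : open O -> O p ->
  (forall q, O q -> f q = 0) -> dfun f p v = 0.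
Proof.
move=> oO Op f0; rewrite /dfun.
rewrite -(derive_cst (0 : R) (cmap (chart_at p) p) v).
apply: near_eq_derive; apply: open_near_eq (open_chart_img (p := p) oO) _ _.
  by apply: mem_chart_img => //; exact: mem_chart_at.
by move=> x /chart_imgP[r [pr Or -> _]]; rewrite /= cmapK // f0.
Qed.

End Charts.

(** * The horizontal projection *)

Section HorizontalMatrix.
Variables (R : realFieldType) (m n : nat) (G : 'M[R]_m) (A : 'M[R]_(m, n)).
Hypothesis Gpos : forall u : 'rV_m, u != 0 -> 0 < (u *m G *m u^T) 0 0.
Hypothesis Gsym : G^T = G.
Hypothesis Asurj : forall w : 'rV_n, exists v : 'rV_m, v *m A = w.

(** For row vectors, the projection along {v | v A = 0} onto its [G]-orthogonal complement, the row
    space of A^T G^-1. *)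
Definition horizontal_mx : 'M[R]_m :=
  A *m invmx (A^T *m invmx G *m A) *m A^T *m invmx G.

Lemma posdef_unitmx : G \in unitmx.
Proof.
rewrite -row_free_unit; apply: inj_row_free => u uG0; apply/eqP.
by apply: contraT => /Gpos; rewrite uG0 mul0mx mxE ltxx.
Qed.

(** If y is in the left kernel, z = y A^T G^-1 satisfies z A = 0, so z G z^T = y (z A)^T = 0 and z =
    0; then y A^T = 0. *)
Lemma horizontal_gram_unitmx : A^T *m invmx G *m A \in unitmx.
Proof.
have Gu := posdef_unitmx.
rewrite -row_free_unit; apply: inj_row_free => y y0.
pose z := y *m A^T *m invmx G.
have zA0 : z *m A = 0 by rewrite -y0 /z !mulmxA.
have zG : z *m G = y *m A^T by rewrite /z mulmxKV.
have z0 : z = 0.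
  apply/eqP; apply: contraT => /Gpos.
  by rewrite zG -mulmxA -trmx_mul zA0 trmx0 mulmx0 mxE ltxx.
have yA0 : y *m A^T = 0 by rewrite -zG z0 mul0mx.
(* With y = v A, y A^T = 0 gives y y^T = 0, a sum of squares. *)
have [v vA] := Asurj y.
have : y *m (v *m A)^T = 0 by rewrite trmx_mul mulmxA yA0 mul0mx.
rewrite vA => /matrixP/(_ 0 0); rewrite !mxE => yy.
apply/matrixP => i j; rewrite [i]ord1 mxE; apply/eqP; rewrite -sqrf_eq0.
move/eqP: yy; rewrite psumr_eq0; last by move=> k _; rewrite mxE -expr2 sqr_ge0.
by move=> /allP/(_ j (mem_index_enum j))/implyP/(_ isT); rewrite mxE -expr2.
Qed.

Lemma horizontal_mxK : horizontal_mx *m A = A.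
Proof.
rewrite /horizontal_mx -!mulmxA [A^T *m _]mulmxA mulVmx ?mulmx1 //.
exact: horizontal_gram_unitmx.
Qed.

Lemma horizontal_mx_orth (v u : 'rV_m) :
  u *m A = 0 -> v *m horizontal_mx *m G *m u^T = 0.
Proof.
move=> uA0; rewrite /horizontal_mx !mulmxA (mulmxKV posdef_unitmx).
by rewrite -mulmxA -trmx_mul uA0 trmx0 mulmx0.
Qed.

End HorizontalMatrix.

(** * Orthogonal components for an inner product on a tangent space *)

Section Component.
Variables (R : realType) (m : nat).
Implicit Types (A B : set 'rV[R]_m) (b : 'rV[R]_m -> 'rV[R]_m -> R).

Definition sub_closed A := forall u v, A u -> A v -> A (u - v).

Definition inner_product b :=
  [/\ forall a u v w, b (a *: u + v) w = a * b u w + b v w,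
      forall u v, b u v = b v u
    & forall u, u != 0 -> 0 < b u u].

Section InnerProduct.
Variable b : 'rV[R]_m -> 'rV[R]_m -> R.
Hypothesis hb : inner_product b.

Lemma inner_sym u v : b u v = b v u. Proof. by have [_ ->] := hb. Qed.

Lemma innerPl a u v w : b (a *: u + v) w = a * b u w + b v w.
Proof. by have [->] := hb. Qed.

Lemma innerDl u v w : b (u + v) w = b u w + b v w.
Proof. by rewrite -{1}[u]scale1r innerPl mul1r. Qed.

Lemma inner0l w : b 0 w = 0.
Proof. by apply: (addIr (b 0 w)); rewrite -innerDl addr0 add0r. Qed.

Lemma innerZl a u w : b (a *: u) w = a * b u w.
Proof. by rewrite -[_ *: _]addr0 innerPl inner0l addr0. Qed.

Lemma innerNl u w : b (- u) w = - b u w.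
Proof. by rewrite -scaleN1r innerZl mulN1r. Qed.

Lemma innerBl u v w : b (u - v) w = b u w - b v w.
Proof. by rewrite innerDl innerNl. Qed.

Lemma innerDr u v w : b w (u + v) = b w u + b w v.
Proof. by rewrite inner_sym innerDl !(inner_sym w). Qed.

Lemma innerNr u w : b w (- u) = - b w u.
Proof. by rewrite inner_sym innerNl inner_sym. Qed.

Lemma innerBr u v w : b w (u - v) = b w u - b w v.
Proof. by rewrite innerDr innerNr. Qed.

Lemma innerZr a u w : b w (a *: u) = a * b w u.
Proof. by rewrite inner_sym innerZl inner_sym. Qed.

Lemma inner_suml (I : Type) (r : seq I) (f : I -> 'rV[R]_m) w :
  b (\sum_(i <- r) f i) w = \sum_(i <- r) b (f i) w.
Proof. by apply: (big_morph (b^~ w)) => [u v|]; rewrite ?innerDl ?inner0l. Qed.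

Lemma inner_sumr (I : Type) (r : seq I) (f : I -> 'rV[R]_m) w :
  b w (\sum_(i <- r) f i) = \sum_(i <- r) b w (f i).
Proof. by rewrite inner_sym inner_suml; apply: eq_bigr => i _; rewrite inner_sym. Qed.

Lemma inner_eq0 u : b u u = 0 -> u = 0.
Proof.
move=> u0; apply/eqP; apply: contraT => un0.
by have [_ _ /(_ u un0)] := hb; rewrite u0 ltxx.
Qed.

(** Pairing with a basis of [D] is injective on [D] by positivity, hence onto by dimension; so some
    [u] in [D] has the same pairings as [v]. *)
Lemma inner_proj (D : {vspace 'rV[R]_m}) v :
  exists2 u, u \in D & forall x, x \in D -> b (v - u) x = 0.
Proof.
pose f x : 'rV[R]_(\dim D) := \row_i b x (vbasis D)`_i.
have f_lin : linear f.
  by move=> a x y; apply/rowP => i; rewrite !mxE innerPl.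
pose fM := GRing.isLinear.Build _ _ _ _ f f_lin.
pose fL : {linear 'rV[R]_m -> 'rV[R]_(\dim D)} := HB.pack f fM.
have f0 x y : f x = 0 -> y \in D -> b x y = 0.
  move=> fx0 /coord_vbasis ->; rewrite inner_sumr big1 // => i _.
  by rewrite innerZr; move/rowP/(_ i): fx0; rewrite !mxE => ->; rewrite mulr0.
have kerD : (D :&: lker (linfun fL))%VS = 0%VS.
  apply/eqP; rewrite -subv0; apply/subvP => x; rewrite memv_cap memv_ker lfunE.
  by move=> /andP[xD /eqP fx0]; rewrite memv0 (inner_eq0 (f0 _ _ fx0 xD)).
have fD : (linfun fL @: D)%VS = fullv.
  apply/eqP; rewrite eqEdim subvf dimvf (limg_dim_eq kerD) /=.
  by rewrite /dim /= mul1n.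
have /memv_imgP[u uD fu] : linfun fL v \in (linfun fL @: D)%VS by rewrite fD memvf.
exists u => // x xD; apply: f0 => //.
by move: fu; rewrite !lfunE /= => fu; rewrite -[f _]/(fL _) linearB /= fu subrr.
Qed.

(** [component] is a choice, and this identifies it: the difference of two candidates lies in both
    [A] and [B], so it is orthogonal to itself. *)
Lemma componentE A B v u : sub_closed A -> sub_closed B ->
  (forall x y, A x -> B y -> b x y = 0) ->
  A u -> B (v - u) -> component A B v = u.
Proof.
move=> subA subB AB Au Bu; rewrite /component.
have : [set u' | A u' /\ B (v - u')] (xget 0 [set u' | A u' /\ B (v - u')]).
  by apply: xgetPex; exists u.
set u' := xget _ _ => -[Au' Bu'].
apply/eqP; rewrite -subr_eq0; apply/eqP/inner_eq0.
apply: AB; first exact: subA.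
have -> : u' - u = (v - u) - (v - u') by rewrite opprB [RHS]addrC addrA subrK.
exact: subB.
Qed.

End InnerProduct.
End Component.

Lemma riemannian_inner (R : realType) m (M : manifold R m) g (p : M) :
  riemannian_metric g -> inner_product (g p).
Proof. by move=> [gl gs gp _]; split => *; [exact: gl | exact: gs | exact: gp]. Qed.

Section Gram.
Variables (R : realType) (m : nat) (M : manifold R m).
Variable g : M -> 'rV[R]_m -> 'rV[R]_m -> R.
Hypothesis hg : riemannian_metric g.

(** The frame comes from the chart at [p]: the coordinates of the tangent space at [r] use the chart
    chosen at [r], which need not vary continuously with [r]. *)
Definition gram (p r : M) : 'M[R]_m := \matrix_(i, j)
  g r (chart_frame p (delta_mx 0 i) r) (chart_frame p (delta_mx 0 j) r).

Lemma gramE (p r : M) u v :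
  g r (chart_frame p u r) (chart_frame p v r) = (u *m gram p r *m v^T) 0 0.
Proof.
have hb := riemannian_inner r hg.
have frameE w : chart_frame p w r = \sum_i w 0 i *: chart_frame p (delta_mx 0 i) r.
  rewrite {1}/chart_frame {1}[w]row_sum_delta mulmx_suml.
  by apply: eq_bigr => i _; rewrite -scalemxAl.
rewrite (frameE u) inner_suml // -mulmxA mxE; apply: eq_bigr => i _.
rewrite innerZl // (frameE v) inner_sumr // mxE; congr (_ * _).
by apply: eq_bigr => j _; rewrite innerZr // !mxE mulrC.
Qed.

Lemma gram_sym (p r : M) : (gram p r)^T = gram p r.
Proof. by apply/matrixP => i j; rewrite !mxE; have [_ -> _ _] := hg. Qed.

Lemma gram_pos (p r : M) (u : 'rV[R]_m) : cdom (chart_at p) r -> u != 0 ->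
  0 < (u *m gram p r *m u^T) 0 0.
Proof.
move=> pr u0; rewrite -gramE; have [_ _ gp _] := hg; apply: gp.
apply: contra u0 => /eqP fu0; apply/eqP.
rewrite -[u]mulmx1 -(chart_jacK pr (mem_chart_at r)) mulmxA.
by rewrite -[u *m _]/(chart_frame p u r) fu0 mul0mx.
Qed.

Lemma smooth_gram (p : M) : smooth_on (chart_img p (cdom (chart_at p)))
  (fun x => gram p (cinv (chart_at p) x)).
Proof.
have op := cdom_open (chart_at p); have oI := open_chart_img (p := p) op.
apply: smooth_on_mx => // i j; have [_ _ _ gs] := hg.
have := gs _ _ _ op (@smooth_chart_frame _ _ _ p (delta_mx 0 i))
  (@smooth_chart_frame _ _ _ p (delta_mx 0 j)) p.
by apply: (smooth_on_eq (W := R) oI) => x _; rewrite mxE.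
Qed.

End Gram.

(** * Smoothness of the horizontal projection *)

Section HorizontalProjection.
Variables (R : realType) (m n : nat) (M : manifold R m) (N : manifold R n).
Variable g : M -> 'rV[R]_m -> 'rV[R]_m -> R.
Variable F : M -> N.
Hypothesis hg : riemannian_metric g.
Hypothesis Fs : smooth_map F.
Hypothesis Fsub : forall p w, exists v, push F p v = w.

Lemma vertical_sub_closed p : sub_closed (vertical F p).
Proof.
move=> u v; rewrite /vertical /= !(pushE Fs) => u0 v0.
by rewrite mulmxBl u0 v0 subr0.
Qed.

Lemma horizontal_sub_closed p : sub_closed (horizontal g F p).
Proof.
move=> u v hu hv x vx; rewrite innerBl ?hu ?hv ?subr0 //.
exact: riemannian_inner.
Qed.

(** [push] is computed in the charts chosen at [r] and [F r]; factoring through fixed charts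
    isolates a matrix depending smoothly on [r]. *)
Lemma push_chart p q r : cdom (chart_at p) r -> cdom (chart_at q) (F r) ->
  chart_jac F r (F r) r = chart_jac id r p r *m chart_jac F p q r
                          *m chart_jac id q (F r) (F r).
Proof.
move=> pr qr.
rewrite -(@chart_jac_comp _ _ _ _ M M N id F r p q r) //.
- rewrite -(@chart_jac_comp _ _ _ _ M N N (F \o id) id r q (F r) r) //.
  + exact: smooth_map_id.
  + exact: mem_chart_at.
  + exact: mem_chart_at.
- exact: smooth_map_id.
- exact: mem_chart_at.
Qed.

Lemma vertical_chart p q r v : cdom (chart_at p) r -> cdom (chart_at q) (F r) ->
  vertical F r v <-> tcoord p r v *m chart_jac F p q r = 0.
Proof.
move=> pr qr; rewrite /vertical /= (pushE Fs) (push_chart pr qr) !mulmxA.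
rewrite -(tcoordE v pr); split=> [|->]; last by rewrite mul0mx.
move/(congr1 (mulmx^~ (chart_jac id (F r) q (F r)))).
rewrite -mulmxA (chart_jacK qr (mem_chart_at (F r))).
by rewrite mulmx1 mul0mx.
Qed.

Lemma chart_jac_surj p q r : cdom (chart_at p) r -> cdom (chart_at q) (F r) ->
  forall w : 'rV[R]_n, exists v : 'rV[R]_m, v *m chart_jac F p q r = w.
Proof.
move=> pr qr w.
have [v] := Fsub r (w *m chart_jac id q (F r) (F r)).
rewrite (pushE Fs) (push_chart pr qr) !mulmxA.
move/(congr1 (mulmx^~ (chart_jac id (F r) q (F r)))).
rewrite -!mulmxA (chart_jacK qr (mem_chart_at (F r))) !mulmx1 => vE.
by exists (v *m chart_jac id r p r); rewrite -mulmxA.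
Qed.

Lemma horizontal_chart p q r v : cdom (chart_at p) r -> cdom (chart_at q) (F r) ->
  let u := chart_frame p
    (tcoord p r v *m horizontal_mx (gram g p r) (chart_jac F p q r)) r in
  horizontal g F r u /\ vertical F r (v - u).
Proof.
move=> pr qr u.
have Gpos := fun u => @gram_pos _ _ _ _ hg p r u pr.
have Gsym := gram_sym hg p r.
have As := chart_jac_surj pr qr.
split=> [x /(vertical_chart _ pr qr) x0|].
  by rewrite -(chart_frameK x pr) gramE // (horizontal_mx_orth Gpos _ x0) mxE.
apply/(vertical_chart _ pr qr).
rewrite (tcoordE _ pr) mulmxBl -!(tcoordE _ pr) tcoord_chart_frame //.
rewrite chart_jac_id // mulmx1 mulmxBl -mulmxA horizontal_mxK //.
by rewrite subrr.
Qed.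

Lemma horproj_chart p q r v : cdom (chart_at p) r -> cdom (chart_at q) (F r) ->
  horproj g F r v = chart_frame p
    (tcoord p r v *m horizontal_mx (gram g p r) (chart_jac F p q r)) r.
Proof.
move=> pr qr; have [hu vu] := horizontal_chart v pr qr.
apply: (componentE (riemannian_inner r hg)).
- exact: horizontal_sub_closed.
- exact: vertical_sub_closed.
- by move=> x y hx; exact: hx.
- exact: hu.
- exact: vu.
Qed.

Lemma horprojP r v :
  horizontal g F r (horproj g F r v) /\ vertical F r (v - horproj g F r v).
Proof.
rewrite (horproj_chart _ (mem_chart_at r) (mem_chart_at (F r))).
exact: horizontal_chart (mem_chart_at r) (mem_chart_at (F r)).
Qed.

Lemma verprojE r v : verproj g F r v = v - horproj g F r v.
Proof.
have [hh vv] := horprojP r v.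
apply: (componentE (riemannian_inner r hg)).
- exact: vertical_sub_closed.
- exact: horizontal_sub_closed.
- by move=> x y vx hy; rewrite (inner_sym (riemannian_inner r hg)); exact: hy.
- exact: vv.
- by rewrite subKr; exact: hh.
Qed.

Lemma horproj_horizontal r v : horizontal g F r v -> horproj g F r v = v.
Proof.
move=> hv; apply: (componentE (riemannian_inner r hg)).
- exact: horizontal_sub_closed.
- exact: vertical_sub_closed.
- by move=> x y hx; exact: hx.
- exact: hv.
- by rewrite subrr /vertical /= (pushE Fs) mul0mx.
Qed.

Lemma horproj_vertical r v : vertical F r v -> horproj g F r v = 0.
Proof.
move=> hv; apply: (componentE (riemannian_inner r hg)).
- exact: horizontal_sub_closed.
- exact: vertical_sub_closed.
- by move=> x y hx; exact: hx.
- by move=> x _; rewrite inner0l //; exact: riemannian_inner.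
- by rewrite subr0; exact: hv.
Qed.

Lemma smooth_horproj (O : set M) X : open O ->
  smooth_vf O X -> smooth_vf O (fun r => horproj g F r (X r)).
Proof.
move=> oO /(smooth_vfP _ oO) Xs; apply/(smooth_vfP _ oO) => p.
apply: smooth_on_local => _ /chart_imgP[r [pr Or -> _]].
(* Smoothness is local: on [U] the single target chart at [F r] serves all points. *)
pose q := F r; pose U := O `&` F @^-1` cdom (chart_at q).
have oU : open U by apply: openI => //; exact: open_preimage_chart.
have oI := open_chart_img (p := p) oU.
exists (chart_img p U).
  by apply: mem_chart_img => //; split => //; exact: mem_chart_at.
have sub_img B : (forall s, cdom (chart_at p) s -> U s -> B s) ->
    chart_img p U `<=` chart_img p B.
  by move=> UB _ [s [ps Us] <-]; apply: mem_chart_img => //; exact: UB.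
pose G x := gram g p (cinv (chart_at p) x).
pose A x := chart_jac F p q (cinv (chart_at p) x).
have As : smooth_on (chart_img p U) A.
  by apply: smooth_on_sub (@smooth_chart_jac _ _ _ _ _ _ Fs p q); apply: sub_img => s _ [].
have Gs : smooth_on (chart_img p U) G.
  by apply: smooth_on_sub (@smooth_gram _ _ _ _ hg p); apply: sub_img.
have GVs : smooth_on (chart_img p U) (fun x => invmx (G x)).
  apply: smooth_on_invmx => // _ /chart_imgP[s [ps _ -> _]].
  by rewrite /G cmapK //; apply: posdef_unitmx => u; exact: gram_pos.
have ATs := smooth_on_trmx oI As.
apply: (smooth_on_eq oI (f := fun x =>
    tcoord p (cinv (chart_at p) x) (X (cinv (chart_at p) x))
    *m horizontal_mx (G x) (A x))).
  move=> _ /chart_imgP[s [ps [Os qs] -> _]]; rewrite /G /A !cmapK //.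
  rewrite (horproj_chart _ ps qs) tcoord_chart_frame // chart_jac_id //.
  by rewrite mulmx1.
apply: smooth_on_mulmx => //.
  by apply: smooth_on_sub (Xs p); apply: sub_img => s _ [].
apply: smooth_on_mulmx => //; apply: smooth_on_mulmx => //.
apply: smooth_on_mulmx => //; apply: smooth_on_invmx => //.
  move=> _ /chart_imgP[s [ps [Os qs] -> _]]; rewrite /G /A cmapK //.
  apply: horizontal_gram_unitmx; first by move=> u; exact: gram_pos.
  exact: chart_jac_surj.
by apply: smooth_on_mulmx => //; exact: smooth_on_mulmx.
Qed.

End HorizontalProjection.

(** * The conditions (VI) *)

Section SemiInvariant.
Variables (R : realType) (m n : nat) (M : manifold R m) (N : manifold R n).
Variables (E : M -> {vspace 'End('rV[R]_m)}).
Variables (gM : M -> 'rV[R]_m -> 'rV[R]_m -> R) (gN : N -> 'rV[R]_n -> 'rV[R]_n -> R).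
Variable nablaM : M -> 'rV[R]_m -> (M -> 'rV[R]_m) -> 'rV[R]_m.
Variable nablaF : M -> 'rV[R]_m -> (M -> 'rV[R]_n) -> 'rV[R]_n.
Variables (F : M -> N) (lam : M -> R) (O : set M).
Variables (J : 'Z_3 -> M -> 'End('rV[R]_m)) (D1 : M -> {vspace 'rV[R]_m}).
Variable w : 'Z_3 -> M -> {scalar 'rV[R]_m}.
Hypothesis gM_metric : riemannian_metric gM.
Hypothesis gN_metric : riemannian_metric gN.
Hypothesis nablaM_lc : levi_civita gM nablaM.
Hypothesis nablaF_conn : connection_along F nablaF.
Hypothesis F_sub : h_conformal_submersion gM gN F lam.
Hypothesis J_basis : semi_invariant_basis E gM F J D1 O.
Hypothesis J_conn : connection_forms nablaM O J w.

Local Notation section_D1 := (section O (fun p => [set` D1 p])).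
Local Notation section_H := (section O (horizontal gM F)).

Let hM (p : M) : inner_product (gM p) := riemannian_inner p gM_metric.
Let hN (q : N) : inner_product (gN q) := riemannian_inner q gN_metric.

Let Fs : smooth_map F. Proof. by case: F_sub => _ []. Qed.

Let push_surj : forall p z, exists v, push F p v = z.
Proof. by case: F_sub. Qed.

Let O_open : open O. Proof. by case: J_basis => -[[]]. Qed.

Lemma vertical_D1 p v : O p -> v \in D1 p -> vertical F p v.
Proof. by case: J_basis => _ _ D1v _ _ Op; exact: D1v. Qed.

Lemma J_D1 a p v : O p -> v \in D1 p -> J a p v \in D1 p.
Proof.
case: J_basis => _ _ _ JD _ Op vD.
have : (J a p @` [set` D1 p]) (J a p v) by exists v.
by rewrite JD.
Qed.

Lemma J_skew a p u v : O p -> gM p (J a p u) v = - gM p u (J a p v).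
Proof.
case: J_basis => -[_ _ JJ _ Jg] _ _ _ _ Op.
by rewrite -(Jg a p u) // JJ // (innerNr (hM p)) opprK.
Qed.

Lemma orth_HV p x y : horizontal gM F p x -> vertical F p y -> gM p x y = 0.
Proof. by move=> hx; exact: hx. Qed.

Lemma orth_VH p x y : vertical F p x -> horizontal gM F p y -> gM p x y = 0.
Proof. by move=> vx hy; rewrite (inner_sym (hM p)); exact: hy. Qed.

Lemma sub_closed_D2 p : sub_closed (D2 gM F D1 p).
Proof.
move=> x y [vx x0] [vy y0]; split; first exact: vertical_sub_closed.
by move=> u uD; rewrite (innerBl (hM p)) x0 // y0 // subr0.
Qed.

Lemma sub_closed_JD2 a p : sub_closed (JD2 gM F J D1 a p).
Proof.
move=> _ _ [x xD <-] [y yD <-]; exists (x - y); last by rewrite linearB.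
exact: sub_closed_D2.
Qed.

Lemma sub_closed_mu a p : sub_closed (mu gM F J D1 a p).
Proof.
move=> x y [hx x0] [hy y0]; split; first exact: horizontal_sub_closed.
by move=> u uD; rewrite (innerBl (hM p)) x0 // y0 // subr0.
Qed.

Lemma sub_closed_D1 p : sub_closed [set` D1 p].
Proof. by move=> x y /= xD yD; exact: rpredB. Qed.

Lemma horizontal_JD2 a p v : O p -> D2 gM F D1 p v -> horizontal gM F p (J a p v).
Proof. by case: J_basis => _ _ _ _ JH Op vD; apply: (JH a p Op); exists v. Qed.

Lemma D2_zero p : D2 gM F D1 p 0.
Proof.
split; first by rewrite /vertical /= (pushE Fs) mul0mx.
by move=> u _; exact: inner0l.
Qed.

Lemma JD2_D1_orth a p x y : O p -> JD2 gM F J D1 a p x -> y \in D1 p ->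
  gM p x y = 0.
Proof.
move=> Op [d dD <-] yD; apply: orth_HV (vertical_D1 Op yD).
exact: horizontal_JD2.
Qed.

Lemma phiJ_D1 a p v : O p -> v \in D1 p -> phiJ gM F J D1 a p v = J a p v.
Proof.
move=> Op vD; apply: (componentE (hM p)).
- exact: sub_closed_D1.
- exact: sub_closed_JD2.
- by move=> x y xD yJ; rewrite (inner_sym (hM p)) (JD2_D1_orth Op yJ).
- exact: J_D1.
- by rewrite subrr; exists 0; [exact: D2_zero | rewrite linear0].
Qed.

Lemma omegaJ_D1 a p v : O p -> v \in D1 p -> omegaJ gM F J D1 a p v = 0.
Proof.
move=> Op vD; apply: (componentE (hM p)).
- exact: sub_closed_JD2.
- exact: sub_closed_D1.
- by move=> x y xJ yD; exact: (JD2_D1_orth Op xJ).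
- by exists 0; [exact: D2_zero | rewrite linear0].
- by rewrite subr0; exact: J_D1.
Qed.

Lemma omegaJ_D2 a p v : O p -> D2 gM F D1 p v -> omegaJ gM F J D1 a p v = J a p v.
Proof.
move=> Op vD; apply: (componentE (hM p)).
- exact: sub_closed_JD2.
- exact: sub_closed_D1.
- by move=> x y xJ yD; exact: (JD2_D1_orth Op xJ).
- by exists v.
- by rewrite subrr; exact: mem0v.
Qed.

Lemma orth_J_horizontal_D1 a p u v : O p -> horizontal gM F p v -> u \in D1 p ->
  gM p u (J a p v) = 0.
Proof.
move=> Op hv uD; rewrite (inner_sym (hM p)) J_skew // orth_HV ?oppr0 //.
by apply: vertical_D1 => //; exact: J_D1.
Qed.

(** J_a is skew and preserves D_1, so it sends horizontal vectors into the orthogonal complement of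
    D_1. *)
Lemma verproj_J_D2 a p v : O p -> horizontal gM F p v ->
  D2 gM F D1 p (verproj gM F p (J a p v)).
Proof.
move=> Op hv; have [hh vv] := horprojP gM_metric Fs push_surj p (J a p v).
rewrite verprojE //; split => // u uD.
rewrite (innerBl (hM p)) (orth_HV hh (vertical_D1 Op uD)).
by rewrite (inner_sym (hM p)) orth_J_horizontal_D1 // subr0.
Qed.

(** For d in D_2, g(J_a v, J_a d) = g(v, d) = 0, and the vertical part of J_a v does not pair with
    the horizontal vector J_a d. *)
Lemma horproj_J_mu a p v : O p -> horizontal gM F p v ->
  mu gM F J D1 a p (horproj gM F p (J a p v)).
Proof.
move=> Op hv; have [hh vv] := horprojP gM_metric Fs push_surj p (J a p v).
have verD := verproj_J_D2 a Op hv; split=> // _ [d dD <-].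
rewrite -[horproj _ _ _ _](subKr (J a p v)) -verprojE // (innerBl (hM p)).
rewrite (orth_VH verD.1 (horizontal_JD2 a Op dD)) subr0.
case: J_basis => -[_ _ _ _ Jg] _ _ _ _; rewrite Jg //.
exact: orth_HV dD.1.
Qed.

(** On horizontal vectors B and C are thus the vertical and horizontal parts of J_a, so
    [smooth_horproj] governs their smoothness. *)
Lemma BJ_horizontal a p v : O p -> horizontal gM F p v ->
  BJ gM F J D1 a p v = verproj gM F p (J a p v).
Proof.
move=> Op hv; apply: (componentE (hM p)).
- exact: sub_closed_D2.
- exact: sub_closed_mu.
- by move=> x y [vx _] [hy _]; exact: orth_VH.
- exact: verproj_J_D2.
- by rewrite verprojE // subKr; exact: horproj_J_mu.
Qed.

Lemma CJ_horizontal a p v : O p -> horizontal gM F p v ->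
  CJ gM F J D1 a p v = horproj gM F p (J a p v).
Proof.
move=> Op hv; apply: (componentE (hM p)).
- exact: sub_closed_mu.
- exact: sub_closed_D2.
- by move=> x y [hx _] [vy _]; exact: orth_HV.
- exact: horproj_J_mu.
- by rewrite -verprojE //; exact: verproj_J_D2.
Qed.

Lemma smooth_J a X : smooth_vf O X -> smooth_vf O (fun q => J a q (X q)).
Proof.
case: J_basis => -[[_ Js] _ _ _ _] _ _ _ _ Xs.
exact: (Js a O X O_open (fun _ Oq => Oq) Xs).
Qed.

Lemma section_J a U : section_D1 U -> section_D1 (fun q => J a q (U q)).
Proof.
move=> [Us UD]; split; first exact: smooth_J.
by move=> p Op; apply: J_D1 => //; exact: UD.
Qed.

Lemma smooth_nabla X Y : smooth_vf O X -> smooth_vf O Y ->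
  smooth_vf O (fun p => nablaM p (X p) Y).
Proof.
move=> Xs Ys; have [conn _ _] := nablaM_lc.
have [_ _ _ _ nabla_smooth] := conn O O_open; exact: nabla_smooth.
Qed.

Lemma nabla_eq p v X Y : O p -> smooth_vf O X -> (forall q, O q -> X q = Y q) ->
  nablaM p v X = nablaM p v Y.
Proof.
move=> Op Xs XY; have [conn _ _] := nablaM_lc; have [_ _ _ eqn _] := conn O O_open.
exact: eqn p v X Y Op Xs (smooth_vf_eq O_open XY Xs) XY.
Qed.

Lemma second_form_D1 V Y p : section_D1 Y -> O p ->
  second_fundamental_form nablaM nablaF F V Y p = - push F p (nablaM p (V p) Y).
Proof.
move=> [_ YD] Op; rewrite /second_fundamental_form.
rewrite (connection_along0 Fs _ O_open Op nablaF_conn) ?sub0r // => q Oq.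
exact: vertical_D1 Oq (YD q Oq).
Qed.

Lemma nabla_orth X Y p v : O p -> smooth_vf O X -> smooth_vf O Y ->
  (forall q, O q -> gM q (X q) (Y q) = 0) ->
  gM p (X p) (nablaM p v Y) = - gM p (nablaM p v X) (Y p).
Proof.
move=> Op Xs Ys XY; have [_ compat _] := nablaM_lc.
have := compat O X Y p v O_open Op Xs Ys; rewrite (dfun0 _ O_open Op XY).
by move=> /esym/eqP; rewrite addrC addr_eq0 => /eqP.
Qed.

(** The vertical part of [Z] vanishes on [O], which kills the first term of the tensor. *)
Lemma tensorT_horizontal V Z p : O p -> V p \in D1 p -> smooth_vf O Z ->
  (forall q, O q -> horizontal gM F q (Z q)) ->
  tensorT gM nablaM F V Z p = verproj gM F p (nablaM p (V p) Z).
Proof.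
move=> Op VD Zs Zh.
have nabla_conn : connection_along (@id M) nablaM by case: nablaM_lc.
rewrite /tensorT; have -> : verproj gM F p (V p) = V p.
  by rewrite verprojE // horproj_vertical ?subr0 //; exact: vertical_D1.
rewrite (connection_along0 (smooth_map_id M) _ O_open Op nabla_conn); last first.
  by move=> q Oq; rewrite verprojE // horproj_horizontal ?subrr //; exact: Zh.
rewrite horproj_vertical //; last by rewrite /vertical /= (pushE Fs) mul0mx.
rewrite add0r; congr verproj; apply/esym/nabla_eq => // q Oq.
by rewrite horproj_horizontal //; exact: Zh.
Qed.

(** * Covariant derivatives of sections of D_1 and the defect in (VI) *)

Section Derivatives.
Variables (a : 'Z_3) (U V : M -> 'rV[R]_m).
Hypotheses (UD : section_D1 U) (VD : section_D1 V).

Local Notation JU := (fun q => J a q (U q)).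

(** The connection-form terms are multiples of J_b U, which lie in D_1 and are orthogonal to [y];
    what is left is J_a nabla_V U, and J_a is skew. *)
Lemma nablaJ_horizontal p y : O p -> horizontal gM F p y ->
  gM p (nablaM p (V p) JU) y = - gM p (nablaM p (V p) U) (J a p y).
Proof.
move=> Op hy; have [_ nablaJ] := J_conn.
have /eqP := nablaJ a O U p (V p) O_open (fun _ Oq => Oq) Op UD.1.
rewrite subr_eq => /eqP ->.
have J_orth b : gM p (J b p (U p)) y = 0.
  by apply: orth_VH => //; apply: vertical_D1 => //; apply: J_D1 => //; exact: UD.2.
rewrite (innerDl (hM p)) (innerBl (hM p)) !(innerZl (hM p)) !J_orth.
by rewrite !mulr0 subr0 add0r J_skew.
Qed.

(** With Z = nabla_V U, the left side is lam^2 g(Z, J C X), where J C X = - X - J B X. The part in J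
    B X becomes the tensor term, because U and J B X are orthogonal fields and the metric is
    parallel. *)
Lemma condition_VI_defect X p : O p -> section_H X ->
  let wBX q := omegaJ gM F J D1 a q (BJ gM F J D1 a q (X q)) in
  gN (F p) (second_fundamental_form nablaM nablaF F V JU p)
    (push F p (CJ gM F J D1 a p (X p))) =
  lam p ^+ 2 * gM p (U p) (tensorT gM nablaM F V wBX p)
  - lam p ^+ 2 * gM p (nablaM p (V p) U) (X p).
Proof.
move=> Op [Xs Xh] wBX; have hX := Xh p Op.
have UDp : U p \in D1 p := UD.2 p Op.
have wBXE q : O q -> J a q (verproj gM F q (J a q (X q))) = wBX q.
  move=> Oq; rewrite /wBX BJ_horizontal //; last exact: Xh.
  by rewrite omegaJ_D2 //; apply: verproj_J_D2 => //; exact: Xh.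
(* B X is J X minus its horizontal projection, hence smooth. *)
have wBXs : smooth_vf O wBX.
  have JXs := smooth_J a Xs.
  apply: (smooth_vf_eq O_open wBXE); apply: smooth_J.
  have JX_sub := smooth_vf_sub O_open JXs (smooth_horproj gM_metric Fs push_surj O_open JXs).
  by apply: (smooth_vf_eq O_open) JX_sub => q Oq; rewrite verprojE.
have wBXh q : O q -> horizontal gM F q (wBX q).
  move=> Oq; rewrite -wBXE //; apply: horizontal_JD2 => //.
  by apply: verproj_J_D2 => //; exact: Xh.
rewrite (tensorT_horizontal Op (VD.2 p Op) wBXs wBXh) verprojE //.
have [hT _] := horprojP gM_metric Fs push_surj p (nablaM p (V p) wBX).
rewrite (innerBr (hM p)) (orth_VH (vertical_D1 Op UDp) hT) subr0.
have UwBX q : O q -> gM q (U q) (wBX q) = 0.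
  by move=> Oq; apply: orth_VH (wBXh q Oq); apply: vertical_D1 => //; exact: UD.2.
rewrite (nabla_orth (V p) Op UD.1 wBXs UwBX).
rewrite (second_form_D1 V (section_J a UD) Op).
rewrite CJ_horizontal //; set S := nablaM p (V p) JU.
have [hS vS] := horprojP gM_metric Fs push_surj p S.
have [hC vC] := horprojP gM_metric Fs push_surj p (J a p (X p)).
have -> : push F p S = push F p (horproj gM F p S).
  apply/eqP; rewrite -subr_eq0; move: vS.
  by rewrite /vertical /= !(pushE Fs) -mulmxBl => ->.
case: F_sub => _ _ _ _ conf.
rewrite -[- push F p _]scaleN1r (innerZl (hN (F p))) conf //.
have -> : gM p (horproj gM F p S) (horproj gM F p (J a p (X p))) =
          gM p S (horproj gM F p (J a p (X p))).
  have := orth_VH vS hC; rewrite (innerBl (hM p)) => /eqP.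
  by rewrite subr_eq0 => /eqP ->.
rewrite nablaJ_horizontal // -wBXE // verprojE //.
case: J_basis => -[_ _ JJ _ _] _ _ _ _.
rewrite linearB /= JJ // !(innerBr (hM p)) (innerNr (hM p)).
ring.
Qed.

(** On D_1, phi is J_b and omega is 0, while J_a X is orthogonal to D_1. *)
Lemma omega_terms X p (r : R) : O p -> section_H X ->
  r - lam p ^+ 2 *
        (gM p (w (a + 2) p (V p) *: phiJ gM F J D1 (a + 1) p (U p)) (J a p (X p))
         + gM p (w (a + 2) p (V p) *: omegaJ gM F J D1 (a + 1) p (U p))
             (J a p (X p)))
    + lam p ^+ 2 *
        (gM p (w (a + 1) p (V p) *: phiJ gM F J D1 (a + 2) p (U p)) (J a p (X p))
         + gM p (w (a + 1) p (V p) *: omegaJ gM F J D1 (a + 2) p (U p))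
             (J a p (X p))) = r.
Proof.
move=> Op XH; have UDp : U p \in D1 p := UD.2 p Op.
have J_orth b : gM p (J b p (U p)) (J a p (X p)) = 0.
  by apply: orth_J_horizontal_D1 => //; [exact: XH.2 | exact: J_D1].
rewrite !phiJ_D1 // !omegaJ_D1 // !scaler0 !(innerZl (hM p)) !J_orth.
by rewrite !(inner0l (hM p)) !(mulr0, addr0, subr0).
Qed.

End Derivatives.

Lemma VI_of_totally_geodesic a :
  totally_geodesic nablaM O D1 -> condition_VI gM gN nablaM nablaF F lam J D1 O w a.
Proof.
move=> tg U V X UD VD XH JU wBX.
have JUD : section_D1 JU := section_J a UD.
(* The hypothesis is applied to [JU], itself a section of D_1: its derivative is vertical, so the
   second fundamental form vanishes. *)
have form0 p : O p -> second_fundamental_form nablaM nablaF F V JU p = 0.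
  move=> Op; rewrite (second_form_D1 V JUD Op).
  have := vertical_D1 Op ((tg V JU VD JUD).2 p Op).
  by rewrite /vertical /= => ->; rewrite oppr0.
split; first split.
- by apply: smooth_along_eq (@smooth_along0 _ _ _ _ _ F O) => // p Op; rewrite form0.
- move=> p Op; rewrite form0 //; exists 0; last by rewrite (pushE Fs) mul0mx.
  by split=> [u _|u _]; exact: inner0l.
move=> p Op; rewrite condition_VI_defect // omega_terms //.
rewrite (_ : gM p (nablaM p (V p) U) (X p) = 0).
  by rewrite mulr0 subr0.
apply: orth_VH; last exact: XH.2.
by apply: vertical_D1 => //; exact: (tg V U VD UD).2.
Qed.

Lemma totally_geodesic_of_VI a :
  condition_VI gM gN nablaM nablaF F lam J D1 O w a -> totally_geodesic nablaM O D1.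
Proof.
move=> VI V U VD UD.
have nablaU_s : smooth_vf O (fun p => nablaM p (V p) U).
  by apply: smooth_nabla; [exact: VD.1 | exact: UD.1].
split=> // p Op.
have JUD : section_D1 (fun q => J a q (U q)) := section_J a UD.
set Z := nablaM p (V p) U.
(* The test field is the horizontal part of nabla_V U itself; the equation then yields g(X, X) =
   0. *)
pose X q := horproj gM F q (nablaM q (V q) U).
have XH : section_H X.
  split; first exact: (smooth_horproj gM_metric Fs push_surj O_open nablaU_s).
  by move=> q _; have [] := horprojP gM_metric Fs push_surj q (nablaM q (V q) U).
have [[_ form_mu] VI_eq] := VI U V X UD VD XH.
have [hZ vZ] := horprojP gM_metric Fs push_surj p Z.
have Zv : vertical F p Z.
  have lam_neq0 : lam p ^+ 2 != 0.
    by case: F_sub => _ _ _ [_ lam_gt0] _; rewrite expf_neq0 // gt_eqF.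
  have /eqP := VI_eq p Op; rewrite (omega_terms a V UD _ Op XH).
  rewrite (condition_VI_defect a UD VD Op XH).
  rewrite -subr_eq0 addrAC subrr add0r oppr_eq0 mulf_eq0 (negPf lam_neq0) /=.
  rewrite -/Z -/(X p) -[Z in gM p Z](subrK (X p)) (innerDl (hM p)).
  rewrite (orth_VH vZ hZ) add0r => /eqP/(inner_eq0 (hM p)) X0.
  by rewrite -[Z](subrK (X p)) X0 addr0 -{1}X0.
have Zorth d : D2 gM F D1 p d -> gM p Z d = 0.
  move=> dD; have JdH := horizontal_JD2 a Op dD.
  have := nablaJ_horizontal a V UD Op JdH.
  have -> : J a p (J a p d) = - d by case: J_basis => -[_ _ JJ _ _] _ _ _ _; exact: JJ.
  rewrite (innerNr (hM p)) opprK => <-.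
  (* Here F_* z = - F_* S with z in mu, so S + z is vertical; J_a d is orthogonal to both S + z and
     z, hence to S. *)
  have [z [zH z0]] := form_mu p Op.
  rewrite (second_form_D1 V JUD Op).
  set S := nablaM p (V p) _ => zS.
  have SzV : vertical F p (S + z).
    by rewrite /vertical /= (pushE Fs) mulmxDl -!(pushE Fs) zS subrr.
  rewrite -[S](addrK z) (innerBl (hM p)) (orth_VH SzV JdH) z0 ?subr0 //.
  by exists d.
(* Z - u is vertical and orthogonal to D_1, so it lies in D_2; being orthogonal to both Z and u, it
   is 0. *)
have [u uD Zu] := inner_proj (hM p) (D1 p) Z.
suff -> : Z = u by [].
apply/eqP; rewrite -subr_eq0; apply/eqP/(inner_eq0 (hM p)).
rewrite {1}(innerBl (hM p)) [X in _ - X](inner_sym (hM p)) Zu // subr0.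
apply: Zorth.
exact: (conj (vertical_sub_closed Fs Zv (vertical_D1 Op uD)) Zu).
Qed.

End SemiInvariant.
Theorem theorem3p15 (R : realType) (m n : nat)
    (M : manifold R m) (N : manifold R n)
    (E : M -> {vspace 'End('rV[R]_m)})
    (gM : M -> 'rV[R]_m -> 'rV[R]_m -> R)
    (gN : N -> 'rV[R]_n -> 'rV[R]_n -> R)
    (nablaM : M -> 'rV[R]_m -> (M -> 'rV[R]_m) -> 'rV[R]_m)
    (nablaN : N -> 'rV[R]_n -> (N -> 'rV[R]_n) -> 'rV[R]_n)
    (F : M -> N) (lam : M -> R)
    (nablaF : M -> 'rV[R]_m -> (M -> 'rV[R]_n) -> 'rV[R]_n)
    (O : set M) (J : 'Z_3 -> M -> 'End('rV[R]_m))
    (D1 : M -> {vspace 'rV[R]_m}) (w : 'Z_3 -> M -> {scalar 'rV[R]_m})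
    (hnablaM : levi_civita gM nablaM)
    (hM : quaternionic_kahler E gM nablaM)
    (hN : riemannian_metric gN)
    (hnablaN : levi_civita gN nablaN)
    (hF : h_conformal_semi_invariant_submersion E gM gN F lam)
    (hnablaF : pullback_connection F nablaN nablaF)
    (hJ : semi_invariant_basis E gM F J D1 O)
    (hw : connection_forms nablaM O J w) :
  [<-> totally_geodesic nablaM O D1;
       condition_VI gM gN nablaM nablaF F lam J D1 O w 1;
       condition_VI gM gN nablaM nablaF F lam J D1 O w 2;
       condition_VI gM gN nablaM nablaF F lam J D1 O w 3].
Proof.
have gM_metric : riemannian_metric gM by have [[]] := hM.
have VI a := VI_of_totally_geodesic gM_metric hN hnablaM hnablaF.1 hF.1 hJ hw a.
have tg a := totally_geodesic_of_VI gM_metric hN hnablaM hnablaF.1 hF.1 hJ hw a.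
(* Each implication between two of the conditions (VI) passes through total geodesy. *)
by tfae => [/VI|/tg/VI|/tg/VI|/tg]; exact.
Qed.
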